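(* Let $V$ be a non-zero finite-dimensional real $\mathbb{Z}$-graded vector space with $r_j=\dim V_j$, equipped with a degree $\ell$ metric $g$, where $\ell=-2k$ with $k$ even. Let $i_\bullet\in\mathbb{N}_0$ be such that $r_{k+i_\bullet}\ne0$ and $r_{k+i}=0$ for all $i>i_\bullet$. For $A\in\mathrm{O}(V_\bullet,g)$ and $i\in\{0,\dots,i_\bullet\}$ let $\mathbb{A}_{(i)}\in\mathrm{GL}(r_{k+i},\mathbb{R})$ be the matrix of $A_{k+i}:V_{k+i}\to V_{k+i}$ with respect to the basis of $V_{k+i}$ taken from the standard total basis described in the context. Then the map $A\mapsto(\mathbb{A}_{(i)})_{i=0}^{i_\bullet}$ defines a Lie group isomorphism $$\mathrm{O}(V_\bullet,g)\cong\mathrm{O}(p,q)\times\prod_{i=1}^{i_\bullet}\mathrm{GL}(r_{k+i},\mathbb{R}),$$ where $(p,q)$ is the signature of the restriction $g_k:V_k\times V_k\to\mathbb{R}$ of $g$.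
   Context: A graded vector space is a sequence $V=(V_j)_{j\in\mathbb{Z}}$ of real vector spaces with $\sum_j\dim V_j<\infty$. $V^*$ is the graded dual, $(V^* )_j=(V_{-j})^*$. A degree $\ell$ metric on $V$ is a bilinear map $g:V\times V\to\mathbb{R}$ with $g(v,w)=0$ unless $|v|+|w|+\ell=0$, $g(v,w)=(-1)^{(|v|+\ell)(|w|+\ell)}g(w,v)$, and such that the degree $\ell$ map $g:V\to V^*$ (same symbol), $[g(v)](w):=(-1)^{(|v|+1)\ell}g(v,w)$, is an isomorphism, i.e. all components $V_j\to(V_{-(j+\ell)})^*$ are isomorphisms. Hence $r_j=r_{-(j+\ell)}$ for all $j$; for $\ell=-2k$, $k$ even, $g$ restricts to an ordinary non-degenerate symmetric bilinear form on $V_k$. $\mathrm{GL}(V_\bullet)\cong\prod_j\mathrm{GL}(V_j)$ is the Lie group of invertible degree zero linear maps $A=(A_j)_{j\in\mathbb{Z}}$ of $V$, and $\mathrm{O}(V_\bullet,g)=\{A\in\mathrm{GL}(V_\bullet)\mid A^TgA=g\}$, where $A^T(\xi)=\xi\circ A$ (it is the underlying Lie group of the graded orthogonal group $\mathrm{O}(V,g)$). Standard total basis: for $\ell=-2k$, $k$ even, a total basis (union of bases of the $V_j$) of $V$ consisting of: for $i\in\{1,\dots,i_\bullet\}$, a basis $(t^{(i)}_\alpha)_{\alpha=1}^{r_{k+i}}$ of $V_{k+i}$ and a basis $(\overline{t}^{(i)}_\beta)_{\beta=1}^{r_{k+i}}$ of $V_{k-i}$ with $g(t^{(i)}_\alpha,\overline{t}^{(i)}_\beta)=\delta_{\alpha\beta}$;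 and a basis $(e_a)_{a=1}^{r_k}$ of $V_k$ with $g(e_a,e_b)=\eta_{ab}$, $\eta$ the diagonal matrix with $p$ entries $+1$ and $q$ entries $-1$; all other values of $g$ on basis vectors are zero or obtained by graded symmetry. Such a basis exists and one is fixed. For $i\ge1$, $A_{k+i}(t^{(i)}_\alpha)=\sum_\beta[\mathbb{A}_{(i)}]^\beta{}_\alpha t^{(i)}_\beta$; $\mathbb{A}_{(0)}$ is the matrix of $A_k$ in the basis $(e_a)$. $\mathrm{O}(p,q)$ is the group of matrices $\mathbb{A}$ with $\mathbb{A}^T\eta\mathbb{A}=\eta$. Groups of $0\times0$ matrices are trivial. *)

(* Defs.v *)
From HB Require Import structures.
From mathcomp Require Import all_boot all_order all_algebra.
From mathcomp Require Import all_classical all_reals all_analysis.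

Set Implicit Arguments.
Unset Strict Implicit.
Unset Printing Implicit Defensive.

Import Order.TTheory GRing.Theory Num.Theory.
Import numFieldNormedType.Exports.

Local Open Scope classical_set_scope.
Local Open Scope ring_scope.

(** * Smooth maps and embedded submanifolds of Euclidean space *)

Section Smooth.
Context {R : realType}.

(* [f] is of class C^r at all points of [U]; meant for open [U]. *)
Fixpoint class_C (r n m : nat) (U : set 'rV[R]_n) (f : 'rV[R]_n -> 'rV[R]_m)
    : Prop :=
  match r with
  | 0 => forall x, U x -> {for x, continuous f}
  | r'.+1 => (forall x, U x -> differentiable f x) /\
             (forall v, class_C r' U (fun x => 'D_v f x))
  end.

Definition smooth_on n m (U : set 'rV[R]_n) (f : 'rV[R]_n -> 'rV[R]_m) : Prop :=
  forall r, class_C r U f.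

Definition diffeomorphism n (U W : set 'rV[R]_n) (phi psi : 'rV[R]_n -> 'rV[R]_n)
    : Prop :=
  [/\ open U /\ open W, smooth_on U phi, smooth_on W psi,
      forall x, U x -> W (phi x) /\ psi (phi x) = x
    & forall y, W y -> U (psi y) /\ phi (psi y) = y].

(* Slice charts: near each of its points, [S] is mapped by an ambient
   diffeomorphism onto an open part of a [d]-dimensional linear subspace. *)
Definition embedded_submanifold n (d : nat) (S : set 'rV[R]_n) : Prop :=
  forall x, S x ->
    exists (U W : set 'rV[R]_n) (phi psi : 'rV[R]_n -> 'rV[R]_n)
           (L : {vspace 'rV[R]_n}),
      [/\ U x, diffeomorphism U W phi psi, \dim L = d
        & forall y, U y -> (S y <-> phi y \in L)].

(* On [X], the quantity [d] is, locally, a smooth function of [c].  When [c]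
   identifies [X] with an embedded submanifold, this is smoothness of [d] on
   [X], expressed by local smooth extensions to the ambient Euclidean space. *)
Definition smooth_wrt (T : Type) n m (X : set T)
    (c : T -> 'rV[R]_n) (d : T -> 'rV[R]_m) : Prop :=
  forall x, X x ->
    exists (U : set 'rV[R]_n) (h : 'rV[R]_n -> 'rV[R]_m),
      [/\ open U, U (c x), smooth_on U h
        & forall y, X y -> U (c y) -> d y = h (c y)].

End Smooth.

(** * Lie groups embedded in a Euclidean space *)

(* The elements of the group are those of [eg_set]; [eg_coord] maps them into
   a Euclidean space, whose smooth structure they inherit. *)
Record embedded_group (R : realType) := EmbeddedGroup {
  eg_type : Type;
  eg_set : set eg_type;
  eg_one : eg_type;
  eg_mul : eg_type -> eg_type -> eg_type;
  eg_inv : eg_type -> eg_type;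
  eg_dim : nat;
  eg_coord : eg_type -> 'rV[R]_eg_dim }.

Section LieGroups.
Context {R : realType}.
Implicit Types G H : embedded_group R.

Definition is_group G : Prop :=
  [/\ eg_set (@eg_one R G) /\
      (forall x : eg_type G, eg_set x ->
         eg_mul (@eg_one R G) x = x /\ eg_mul x (@eg_one R G) = x),
      forall x y : eg_type G, eg_set x -> eg_set y -> eg_set (eg_mul x y),
      forall x : eg_type G, eg_set x ->
        [/\ eg_set (eg_inv x), eg_mul (eg_inv x) x = @eg_one R G
          & eg_mul x (eg_inv x) = @eg_one R G]
    & forall x y z : eg_type G, eg_set x -> eg_set y -> eg_set z ->
        eg_mul x (eg_mul y z) = eg_mul (eg_mul x y) z].

Definition is_lie_group G : Prop :=
  [/\ is_group G,
      forall x y : eg_type G, eg_set x -> eg_set y ->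
        eg_coord x = eg_coord y -> x = y,
      exists d, embedded_submanifold d (@eg_coord R G @` @eg_set R G),
      smooth_wrt [set u : eg_type G * eg_type G | eg_set u.1 /\ eg_set u.2]
        (fun u => row_mx (eg_coord u.1) (eg_coord u.2))
        (fun u => eg_coord (eg_mul u.1 u.2))
    & smooth_wrt (@eg_set R G) (@eg_coord R G) (fun x => eg_coord (eg_inv x))].

Definition lie_morphism G H (f : eg_type G -> eg_type H) : Prop :=
  [/\ forall x, eg_set x -> eg_set (f x),
      forall x y, eg_set x -> eg_set y -> f (eg_mul x y) = eg_mul (f x) (f y)
    & smooth_wrt (@eg_set R G) (@eg_coord R G) (fun x => eg_coord (f x))].

Definition lie_isomorphism G H (f : eg_type G -> eg_type H) : Prop :=
  [/\ is_lie_group G, is_lie_group H, lie_morphism f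
    & exists f' : eg_type H -> eg_type G,
        [/\ lie_morphism f', forall x, eg_set x -> f' (f x) = x
          & forall y, eg_set y -> f (f' y) = y]].

Definition lie_prod G H : embedded_group R := {|
  eg_type := (eg_type G * eg_type H)%type;
  eg_set := [set u | eg_set u.1 /\ eg_set u.2];
  eg_one := (@eg_one R G, @eg_one R H);
  eg_mul := fun u v => (eg_mul u.1 v.1, eg_mul u.2 v.2);
  eg_inv := fun u => (eg_inv u.1, eg_inv u.2);
  eg_coord := fun u => row_mx (eg_coord u.1) (eg_coord u.2) |}.

Definition lie_bigprod n (G : 'I_n -> embedded_group R) : embedded_group R := {|
  eg_type := forall i, eg_type (G i);
  eg_set := [set u | forall i, eg_set (u i)];
  eg_one := fun i => @eg_one R (G i);
  eg_mul := fun u v i => eg_mul (u i) (v i);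
  eg_inv := fun u i => eg_inv (u i);
  eg_coord := fun u => \mxrow_(i < n) eg_coord (u i) |}.

Definition GLn (n : nat) : embedded_group R := {|
  eg_type := 'M[R]_n;
  eg_set := [set M | M \in unitmx];
  eg_one := 1%:M;
  eg_mul := fun M N => M *m N;
  eg_inv := @invmx R n;
  eg_coord := fun M => mxvec M |}.

Definition eta (p q : nat) : 'M[R]_(p + q) := block_mx 1%:M 0 0 (- 1%:M).

Definition Opq (p q : nat) : embedded_group R := {|
  eg_type := 'M[R]_(p + q);
  eg_set := [set M | M^T *m eta p q *m M = eta p q];
  eg_one := 1%:M;
  eg_mul := fun M N => M *m N;
  eg_inv := @invmx R (p + q);
  eg_coord := fun M => mxvec M |}.

End LieGroups.

(** * Graded vector spaces and metrics *)

(* Since the dimensions are natural numbers, their sum is finite if and only if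
   almost all of them vanish.  A bound for the nonzero degrees is part of the
   data because it gives coordinates on families of endomorphisms. *)
Record gradedVect (R : realType) := GradedVect {
  gv_comp :> int -> vectType R;
  gv_bound : nat;
  gv_boundP : forall j : int,
    (gv_bound < `|j|)%N -> \dim {: gv_comp j} = 0%N }.

Section Graded.
Context {R : realType} (V : gradedVect R).

Definition gdim (j : int) : nat := \dim {: V j}.

Definition gdual (j : int) : vectType R := 'Hom(V (- j), R^o).

Definition gEnd : Type := forall j : int, 'End(V j).

Definition gEnd_coord (A : gEnd) :=
  \mxrow_(i < (gv_bound V).*2.+1) VectorInternalTheory.v2r (A (i%:Z - (gv_bound V)%:Z)).

Definition gdual_map (A : gEnd) (j : int) (xi : gdual j) : gdual j :=
  (xi \o A (- j))%VF.

(* A bilinear map on [V], given by its values on homogeneous elements. *)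
Definition gform := forall i j : int, V i -> V j -> R.

Definition gflat (l : int) (g : gform) (j : int) (v : V j) : gdual (j + l) :=
  linfun (fun w : V (- (j + l)) => (-1) ^ ((j + 1) * l) * g j (- (j + l)) v w : R^o).

Definition is_metric (l : int) (g : gform) : Prop :=
  [/\ forall i j, bilinear_for *%R *%R (g i j),
      forall i j v w, i + j + l != 0 -> g i j v w = 0,
      forall i j v w, g i j v w = (-1) ^ ((i + l) * (j + l)) * g j i w v
    & forall j, bijective (@gflat l g j)].

Definition is_GL (A : gEnd) : Prop := forall j, bijective (A j).

Definition is_O (l : int) (g : gform) (A : gEnd) : Prop :=
  is_GL A /\
  forall j (v : V j), gdual_map A (gflat l g (A j v)) = gflat l g v.

(* The inverse on 'End(V j) is a right inverse on the image, hence the usual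
   inverse on invertible maps. *)
Definition O_group (l : int) (g : gform) : embedded_group R := {|
  eg_type := gEnd;
  eg_set := [set A | is_O l g A];
  eg_one := fun j => \1%VF;
  eg_mul := fun A B j => (A j \o B j)%VF;
  eg_inv := fun A j => (A j)^-1%VF;
  eg_coord := gEnd_coord |}.

(* The index [i : 'I_n] stands for the integer [i + 1] in {1, ..., n}.  The
   remaining values of [g] on basis vectors are determined by the degrees and
   by graded symmetry. *)
Definition standard_total_basis (g : gform) (k : int) (n p q : nat)
    (e : (p + q).-tuple (V k))
    (t : forall i : 'I_n, (gdim (k + i.+1%:Z)).-tuple (V (k + i.+1%:Z)))
    (tbar : forall i : 'I_n, (gdim (k + i.+1%:Z)).-tuple (V (k - i.+1%:Z)))
    : Prop :=
  [/\ basis_of {: V k} e /\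
      (forall i : 'I_n, basis_of {: V (k + i.+1%:Z)} (t i) /\
                 basis_of {: V (k - i.+1%:Z)} (tbar i)),
      forall a b : 'I_(p + q), g k k (tnth e a) (tnth e b) = eta p q a b
    & forall (i : 'I_n) (a b : 'I_(gdim (k + i.+1%:Z))),
        g (k + i.+1%:Z) (k - i.+1%:Z) (tnth (t i) a) (tnth (tbar i) b)
          = (a == b)%:R].

End Graded.

Section LinearAlgebra.
Context {R : realType} (W : vectType R).

(* Column [a] holds the coordinates of the image of the [a]-th basis vector. *)
Definition matrix_in_basis n (b : n.-tuple W) (f : 'End(W)) : 'M[R]_n :=
  \matrix_(c < n, a < n) coord b c (f (tnth b a)).

(* [p] is the largest dimension of a subspace on which [s * b] is positive
   definite. *)
Definition index_of_inertia (s : R) (b : W -> W -> R) (p : nat) : Prop :=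
  let posdef (U : {vspace W}) :=
    forall v, v \in U -> v != 0 -> 0 < s * b v v in
  (exists U : {vspace W}, posdef U /\ \dim U = p) /\
  (forall U : {vspace W}, posdef U -> (\dim U <= p)%N).

Definition has_signature (b : W -> W -> R) (p q : nat) : Prop :=
  index_of_inertia 1 b p /\ index_of_inertia (-1) b q.

End LinearAlgebra.

(* The map A |-> (A_(0), (A_(1), ..., A_(n))). *)
Definition matrix_blocks (R : realType) (V : gradedVect R) (k : int) (n p q : nat)
    (e : (p + q).-tuple (V k))
    (t : forall i : 'I_n, (gdim V (k + i.+1%:Z)).-tuple (V (k + i.+1%:Z)))
    (A : gEnd V) :
    'M[R]_(p + q) * (forall i : 'I_n, 'M[R]_(gdim V (k + i.+1%:Z))) :=
  (matrix_in_basis e (A k), fun i => matrix_in_basis (t i) (A (k + i.+1%:Z))).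

(* Main.v *)
Require Import Defs.
From HB Require Import structures.
From mathcomp Require Import all_boot all_order all_algebra.
From mathcomp Require Import all_classical all_reals all_analysis.
From mathcomp Require Import ring zify.

Set Implicit Arguments.
Unset Strict Implicit.
Unset Printing Implicit Defensive.

Import Order.TTheory GRing.Theory Num.Theory.
Import numFieldNormedType.Exports.

Local Open Scope classical_set_scope.
Local Open Scope ring_scope.

(* An isometry A preserves the pairing of V_(k+i) with V_(k-i), so its component
   on V_(k-i) is the inverse transpose of the one on V_(k+i) in the dual bases;
   the components on V_k and on V_(k+i), i > 0, are thus free, apart from the
   orthogonality condition on V_k.

   Both sides are groups of families of invertible matrices M_i satisfying
   M_i^T H_ij M_j = H_ij for fixed H_ij.  Near a point M0 of such a group, the
   Cayley transform X_i = (N_i - 1)(N_i + 1)^-1 of N = M0^-1 M is an ambient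
   diffeomorphism, and it turns the condition into the linear one
   X_i^T H_ij + H_ij X_j = 0: this gives slice charts without the implicit
   function theorem.  The isomorphism is linear in the coordinates and its
   inverse is linear in the coordinates of y and of y^-1, whence smoothness. *)

(** * Smooth functions *)

Section NearEq.
Context {R : numFieldType} {V W : normedModType R}.
Implicit Types f g : V -> W.

Lemma differentiable_near0 f (x : V) :
  {near x, f =1 (fun _ => 0)} -> differentiable f x.
Proof.
move=> f0; have fx0 : f x = 0 by apply: (nbhs_singleton f0).
have h : f \o shift x = cst (f x) + (0 : V -> W) +o_ 0 id.
  apply/eqaddoP => _/posnumP[eps].
  have : \forall y \near (0 : V), f (y + x) = 0.
    by have := f0; rewrite (near_shift 0 x) /= subr0.
  apply: filterS => y /=; rewrite !fctE /= => ->.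
  by rewrite fx0 addr0 subrr normr0 mulr_ge0.
have d0 : 'd f x = 0 :> (V -> W).
  by apply/diff_unique => //; apply: cst_continuous.
apply/diff_locallyP; rewrite d0; split => //; apply: cst_continuous.
Qed.

(** The difference [g - f] vanishes near [x], hence has zero differential there, and adding it to
    [f] keeps differentiability. *)
Lemma near_eq_differentiable f g (x : V) :
  {near x, f =1 g} -> differentiable f x -> differentiable g x.
Proof.
move=> fg df; have -> : g = f + (g - f) by rewrite addrC subrK.
apply: differentiableD => //; apply: differentiable_near0.
by apply: filterS fg => y; rewrite !fctE => ->; rewrite subrr.
Qed.

End NearEq.

Section ScalarSmooth.
Context {R : realType} {V : normedModType R}.
Implicit Types (U : set V) (f g : V -> R).

(* [class_C] for scalar functions, which can be multiplied and inverted. *)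
Fixpoint Cr (r : nat) U f : Prop :=
  match r with
  | 0 => forall x, U x -> {for x, continuous f}
  | r'.+1 => (forall x, U x -> differentiable f x) /\
             (forall v, Cr r' U (fun x => 'D_v f x))
  end.

(** As [U] is open, [f] and [g] agree near each of its points, so their derivatives agree on [U] too
    and the induction goes on. *)
Lemma Cr_ext r U f g : open U -> (forall x, U x -> f x = g x) ->
  Cr r U f -> Cr r U g.
Proof.
move=> oU; elim: r f g => [|r IH] f g fg /=.
  move=> cf x Ux; suff: g @ x --> g x by [].
  rewrite -(fg x Ux);apply: cvg_trans (cf x Ux); apply: near_eq_cvg.
  by apply: filterS (open_nbhs_nbhs (conj oU Ux)) => y Uy; rewrite fg.
move=> [df Df]; have nfg x : U x -> {near x, f =1 g}.
  by move=> Ux; apply: filterS (open_nbhs_nbhs (conj oU Ux)) => y Uy; rewrite fg.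
split=> [x Ux|v]; first exact: near_eq_differentiable (nfg x Ux) (df x Ux).
by apply: IH (Df v) => x Ux; apply: near_eq_derive; apply: nfg.
Qed.

(** The product and quotient rules rely on this: the derivative of an expression of order [r.+1]
    contains the functions themselves, taken at order [r]. *)
Lemma CrW r U f : Cr r.+1 U f -> Cr r U f.
Proof.
elim: r f => [|r IH] f [df Df] /=.
  by move=> x Ux; apply: differentiable_continuous; apply: df.
by split=> // v; apply: IH.
Qed.

Lemma Cr_cst r U (c : R) : Cr r U (fun=> c).
Proof.
elim: r c => [|r IH] c /=; first by move=> x _; apply: cst_continuous.
split=> [x _|v]; first exact: differentiable_cst.
rewrite (_ : (fun x => _) = fun=> 0 : R); first exact: (IH 0).
by apply/funext => x; rewrite derive_cst.
Qed.

Lemma CrD r U f g : open U -> Cr r U f -> Cr r U g ->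
  Cr r U (fun x => f x + g x).
Proof.
move=> oU; elim: r f g => [|r IH] f g /=.
  by move=> cf cg x Ux; apply: continuousD; [apply: cf|apply: cg].
move=> [df Df] [dg Dg]; split=> [x Ux|v].
  by apply: differentiableD; [apply: df|apply: dg].
apply: Cr_ext (IH _ _ (Df v) (Dg v)) => // x Ux.
by rewrite deriveD //; apply: diff_derivable; [apply: df|apply: dg].
Qed.

Lemma CrM r U f g : open U -> Cr r U f -> Cr r U g ->
  Cr r U (fun x => f x * g x).
Proof.
move=> oU; elim: r f g => [|r IH] f g.
  by move=> cf cg x Ux; apply: continuousM; [apply: cf|apply: cg].
move=> Hf Hg; have [df Df] := Hf; have [dg Dg] := Hg; split=> [x Ux|v].
  by apply: differentiableM; [apply: df|apply: dg].
apply: Cr_ext (CrD oU (IH _ _ (CrW Hf) (Dg v)) (IH _ _ (CrW Hg) (Df v))) => // x Ux.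
by rewrite deriveM //; apply: diff_derivable; [apply: df|apply: dg].
Qed.

(** The derivative of [1/f] is [- (1/f)^2 f'], and the factor [1/f] has order [r] by induction. *)
Lemma CrV r U f : open U -> (forall x, U x -> f x != 0) -> Cr r U f ->
  Cr r U (fun x => (f x)^-1).
Proof.
move=> oU f0; elim: r => [|r IH].
  by move=> cf x Ux; apply: continuousV; [apply: f0|apply: cf].
move=> Hf; have [df Df] := Hf; split=> [x Ux|v].
  by apply: differentiableV; [apply: df|apply: f0].
have Hi := IH (CrW Hf).
apply: Cr_ext (CrM oU (Cr_cst r U (-1)) (CrM oU (CrM oU Hi Hi) (Df v))) => // x Ux.
rewrite deriveV ?f0 //; last by apply: diff_derivable; apply: df.
by rewrite mulN1r -expr2 exprVn scaleNr.
Qed.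

Lemma Cr_sum r U (I : Type) (s : seq I) (P : pred I) (F : I -> V -> R) :
  open U -> (forall i, P i -> Cr r U (F i)) ->
  Cr r U (fun x => \sum_(i <- s | P i) F i x).
Proof.
move=> oU HF; elim: s => [|i s IH].
  by apply: Cr_ext (Cr_cst r U 0) => // x _; rewrite big_nil.
case Pi: (P i); last by apply: Cr_ext IH => // x _; rewrite big_cons Pi.
by apply: Cr_ext (CrD oU (HF i Pi) IH) => // x _; rewrite big_cons Pi.
Qed.

Lemma Cr_prod r U (I : Type) (s : seq I) (P : pred I) (F : I -> V -> R) :
  open U -> (forall i, P i -> Cr r U (F i)) ->
  Cr r U (fun x => \prod_(i <- s | P i) F i x).
Proof.
move=> oU HF; elim: s => [|i s IH].
  by apply: Cr_ext (Cr_cst r U 1) => // x _; rewrite big_nil.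
case Pi: (P i); last by apply: Cr_ext IH => // x _; rewrite big_cons Pi.
by apply: Cr_ext (CrM oU (HF i Pi) IH) => // x _; rewrite big_cons Pi.
Qed.

Lemma Cr_det r U n (F : V -> 'M[R]_n) : open U ->
  (forall a b, Cr r U (fun x => F x a b)) -> Cr r U (fun x => \det (F x)).
Proof.
move=> oU HF; apply: Cr_sum => // s _; apply: CrM => //; first exact: Cr_cst.
exact: Cr_prod.
Qed.

Lemma Cr_addmx r U m n (F G : V -> 'M[R]_(m, n)) : open U ->
  (forall a b, Cr r U (fun x => F x a b)) ->
  (forall a b, Cr r U (fun x => G x a b)) ->
  forall a b, Cr r U (fun x => (F x + G x) a b).
Proof.
move=> oU HF HG a b.
by apply: Cr_ext (CrD oU (HF a b) (HG a b)) => // x _; rewrite mxE.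
Qed.

Lemma Cr_oppmx r U m n (F : V -> 'M[R]_(m, n)) : open U ->
  (forall a b, Cr r U (fun x => F x a b)) ->
  forall a b, Cr r U (fun x => (- F x) a b).
Proof.
move=> oU HF a b.
apply: Cr_ext (CrM oU (Cr_cst r U (-1)) (HF a b)) => // x _.
by rewrite mxE mulN1r.
Qed.

Lemma Cr_mulmx r U m n p (F : V -> 'M[R]_(m, n)) (G : V -> 'M[R]_(n, p)) :
  open U -> (forall a b, Cr r U (fun x => F x a b)) ->
  (forall a b, Cr r U (fun x => G x a b)) ->
  forall a b, Cr r U (fun x => (F x *m G x) a b).
Proof.
move=> oU HF HG a b.
have H : Cr r U (fun x => \sum_c F x a c * G x c b).
  by apply: Cr_sum => // c _; apply: CrM.
by apply: Cr_ext H => // x _; rewrite mxE.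
Qed.

(** Cramer's rule: the entries are cofactors, polynomial in the entries of [F], divided by a
    determinant without zeros on [U]. *)
Lemma Cr_invmx r U n (F : V -> 'M[R]_n) : open U ->
  (forall x, U x -> F x \in unitmx) ->
  (forall a b, Cr r U (fun x => F x a b)) ->
  forall a b, Cr r U (fun x => invmx (F x) a b).
Proof.
move=> oU uF HF a b.
have H : Cr r U (fun x => (\det (F x))^-1 * (\adj (F x)) a b).
  apply: CrM => //.
    by apply: CrV => // [x /uF|]; [rewrite unitmxE unitfE|apply: Cr_det].
  have H' : Cr r U (fun x => cofactor (F x) b a).
    apply: CrM => //; first exact: Cr_cst.
    apply: Cr_det => // a' b'.
    by apply: Cr_ext (HF (lift b a') (lift a b')) => // x _; rewrite !mxE.
  by apply: Cr_ext H' => // x _; rewrite mxE.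
(* [invmx] follows Cramer's rule on invertible matrices only, so the two functions are compared on
   [U]. *)
by apply: Cr_ext H => // x Ux; rewrite /invmx uF // [RHS]mxE.
Qed.

End ScalarSmooth.

(** * Smoothness of vector-valued maps through their components *)

Section VectorSmooth.
Context {R : realType}.

(** A coordinate is a continuous linear map, hence its own differential; its derivative along [v] is
    the constant [v 0 i]. *)
Lemma Cr_coord r n (U : set 'rV[R]_n) (i : 'I_n) : Cr r U (fun v => v 0 i).
Proof.
case: r => [|r] /=.
  move=> x _.
  exact: (@coord_continuous R 1 n 0 i x).
split=> [x _|v]; first exact: differentiable_coord.
rewrite (_ : (fun x => _) = fun=> v 0 i); first exact: Cr_cst.
apply/funext => x; rewrite deriveE; last exact: differentiable_coord.
pose f := fun v : 'rV[R]_n => v 0 i : R.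
have lf : linear f by move=> c a b; rewrite /f !mxE.
pose fM := GRing.isLinear.Build _ _ _ _ _ lf.
pose fL : {linear 'rV[R]_n -> R} := HB.pack f fM.
by rewrite (@diff_lin _ _ _ fL) //; apply: coord_continuous.
Qed.

(** Continuity, differentiability and derivatives are componentwise, the last at points of
    differentiability; [Cr_ext] limits that comparison to [U]. *)
Lemma class_CP r n m (U : set 'rV[R]_n) (f : 'rV[R]_n -> 'rV[R]_m) :
  open U -> class_C r U f <-> forall i, Cr r U (fun x => f x 0 i).
Proof.
move=> oU; elim: r f => [|r IH] f /=.
  split=> [cf i x Ux|cf x Ux].
    apply: (@continuous_comp _ _ _ f (fun v : 'rV[R]_m => v 0 i)); first exact: cf.
    exact: coord_continuous.
  have H : f @ x --> f x; last by [].
  have FF : Filter (f @ x) by apply: fmap_filter; exact: nbhs_filter.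
  apply/(@cvg_mx_entourageP _ _ _ (f @ x) FF (f x)) => A entA.
  apply: filter_forall => a; apply: filter_forall => b.
  have := cf b x Ux; rewrite ord1 => /cvg_app_entourageP /(_ A entA).
  by apply: filterS => y /=; rewrite inE.
have dP x : differentiable f x <-> forall i, differentiable (fun x => f x 0 i : R) x.
  split=> [df i|df].
    apply: (@differentiable_comp _ _ _ _ f (fun v : 'rV[R]_m => v 0 i : R)) => //.
    exact: differentiable_coord.
  (* Conversely, [f] is the finite sum of its components times the basis rows. *)
  have -> : f = \sum_i (fun x => f x 0 i *: delta_mx 0 i).
    apply/funext => y; rewrite fct_sumE [LHS]row_sum_delta.
    by [].
  apply: differentiable_sum => i; apply: differentiableZl; exact: df.
have DE x v i : differentiable f x -> 'D_v f x 0 i = 'D_v (fun y => f y 0 i : R) x.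
  by move=> df; rewrite derive_mx ?mxE //; apply: diff_derivable.
split=> [[df Df] i|H].
  split=> [x Ux|v]; first by move/dP: (df x Ux).
  by apply: Cr_ext ((IH _).1 (Df v) i) => // x Ux; rewrite DE //; apply: df.
have df x : U x -> differentiable f x.
  by move=> Ux; apply/dP => i; apply: (H i).1.
split=> // v; apply/IH => i.
by apply: Cr_ext ((H i).2 v) => // x Ux; rewrite DE //; apply: df.
Qed.

Lemma smooth_onP n m (U : set 'rV[R]_n) (f : 'rV[R]_n -> 'rV[R]_m) :
  open U -> smooth_on U f <-> forall r i, Cr r U (fun x => f x 0 i).
Proof.
by move=> oU; split=> [H r|H r]; [apply/class_CP|apply/class_CP].
Qed.

Lemma Cr_linear r n m (U : set 'rV[R]_n) (f : 'rV[R]_n -> 'rV[R]_m)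
    (L : 'rV[R]_m -> R) : open U -> linear L ->
  (forall i, Cr r U (fun x => f x 0 i)) -> Cr r U (fun x => L (f x)).
Proof.
move=> oU lL Hf.
pose LM := GRing.isLinear.Build _ _ _ _ _ lL.
pose LL : {linear 'rV[R]_m -> R} := HB.pack L LM.
have H : Cr r U (fun x => \sum_i f x 0 i * L (delta_mx 0 i)).
  by apply: Cr_sum => // i _; apply: CrM => //; apply: Cr_cst.
apply: Cr_ext H => // x _.
have -> : L (f x) = LL (f x) by [].
rewrite [in RHS](row_sum_delta (f x)) (linear_sum LL).
by apply: eq_bigr => i _; rewrite (linearZ_LR LL).
Qed.

End VectorSmooth.

(** * The Cayley transform *)

(** Bundles a function with its linearity proof, so that [linfun], [lker] and the lemmas on linear
    maps apply to maps given by a formula. *)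
Definition linear_of (R : pzRingType) (U W : lmodType R) (f : U -> W)
    (lf : linear f) : {linear U -> W} :=
  HB.pack f (GRing.isLinear.Build _ _ _ _ f lf).

Section Cayley.
Context {R : realType}.

Definition cayley m (M : 'M[R]_m) := (M - 1%:M) *m invmx (M + 1%:M).

Definition cayley_inv m (X : 'M[R]_m) := (1%:M + X) *m invmx (1%:M - X).

(** The Cayley identities below exhibit products equal to the scalar matrix 2, whose factors are
    then invertible. *)
Lemma unitmx_two m : (2%:R : R)%:M \in @unitmx R m.
Proof. by rewrite unitmxE det_scalar unitfE expf_neq0 // pnatr_eq0. Qed.

Lemma cayleyE m (M : 'M[R]_m) : M + 1%:M \in unitmx ->
  cayley M *m (M + 1%:M) = M - 1%:M.
Proof. by move=> uM; rewrite /cayley mulmxKV. Qed.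

Lemma cayley_invE m (X : 'M[R]_m) : 1%:M - X \in unitmx ->
  cayley_inv X *m (1%:M - X) = 1%:M + X.
Proof. by move=> uX; rewrite /cayley_inv mulmxKV. Qed.

Lemma cayleyB m (M : 'M[R]_m) : M + 1%:M \in unitmx ->
  (1%:M - cayley M) *m (M + 1%:M) = 2%:R%:M.
Proof.
move=> uM; rewrite mulmxBl mul1mx cayleyE //.
by apply/matrixP => i j; rewrite !mxE; ring.
Qed.

(** Both sides become [2 M] after multiplication by the invertible matrix [M + 1]. *)
Lemma cayleyD m (M : 'M[R]_m) : M + 1%:M \in unitmx ->
  1%:M + cayley M = M *m (1%:M - cayley M).
Proof.
move=> uM; apply: (can_inj (mulmxK uM)).
rewrite -mulmxA cayleyB // mulmxDl mul1mx cayleyE // mul_mx_scalar.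
by apply/matrixP => i j; rewrite !mxE; ring.
Qed.

Lemma cayley_unit m (M : 'M[R]_m) : M + 1%:M \in unitmx ->
  1%:M - cayley M \in unitmx.
Proof.
by move=> uM; have := unitmx_two m; rewrite -(cayleyB uM) unitmx_mul => /andP[].
Qed.

Lemma cayleyK m (M : 'M[R]_m) : M + 1%:M \in unitmx ->
  cayley_inv (cayley M) = M.
Proof.
by move=> uM; rewrite /cayley_inv cayleyD // mulmxK // cayley_unit.
Qed.

Lemma cayley_invD m (X : 'M[R]_m) : 1%:M - X \in unitmx ->
  (cayley_inv X + 1%:M) *m (1%:M - X) = 2%:R%:M.
Proof.
move=> uX; rewrite mulmxDl mul1mx cayley_invE //.
by apply/matrixP => i j; rewrite !mxE; ring.
Qed.

Lemma cayley_inv_unit m (X : 'M[R]_m) : 1%:M - X \in unitmx ->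
  cayley_inv X + 1%:M \in unitmx.
Proof.
by move=> uX; have := unitmx_two m; rewrite -(cayley_invD uX) unitmx_mul => /andP[].
Qed.

Lemma cayley_invK m (X : 'M[R]_m) : 1%:M - X \in unitmx ->
  cayley (cayley_inv X) = X.
Proof.
move=> uX; have uM := cayley_inv_unit uX.
(* Both sides become [2 X] after multiplication by [cayley_inv X + 1] and then by [1 - X]. *)
apply: (can_inj (mulmxK uM)); rewrite cayleyE //.
apply: (can_inj (mulmxK uX)); rewrite -mulmxA cayley_invD //.
rewrite mulmxBl mul1mx cayley_invE // mul_mx_scalar.
by apply/matrixP => i j; rewrite !mxE; ring.
Qed.

(** Clearing denominators by [(M + 1)^T] and [N + 1] turns [X^T H + H Y] into [(M - 1)^T H (N + 1) +
    (M + 1)^T H (N - 1)]; the mixed terms cancel and leave twice [M^T H N - H]. *)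
Lemma cayley_isometry m n (M : 'M[R]_m) (N : 'M[R]_n) (H : 'M[R]_(m, n)) :
  M + 1%:M \in unitmx -> N + 1%:M \in unitmx ->
  M^T *m H *m N = H <-> (cayley M)^T *m H + H *m cayley N = 0.
Proof.
move=> uM uN.
have := cayleyE uN; have := cayleyE uM.
move: (cayley M) (cayley N) => X Y eX eY.
have key : (M + 1%:M)^T *m (X^T *m H + H *m Y) *m (N + 1%:M)
    = 2%:R *: (M^T *m H *m N - H).
  rewrite (mulmxDr (M + _)^T) mulmxDl !mulmxA -trmx_mul eX -(mulmxA _ Y) eY.
  rewrite !linearD /= !linearN /= trmx1.
  rewrite !(mulmxDl, mulmxDr, mulmxN, mulNmx, mul1mx, mulmx1).
  by apply/matrixP => i j; rewrite !mxE; ring.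
split=> [E|E].
  move: key; rewrite E subrr scaler0.
  move/(canRL (mulmxK uN)); rewrite mul0mx.
  have uMT : (M + 1%:M)^T \in unitmx by rewrite unitmx_tr.
  by move/(canRL (mulKmx uMT)); rewrite mulmx0.
move: key; rewrite E mulmx0 mul0mx => /esym /eqP.
by rewrite scaler_eq0 pnatr_eq0 /= subr_eq0 => /eqP.
Qed.

End Cayley.

(** * Groups of block matrices preserving bilinear forms *)

Lemma open_nonzero (R : realType) n (f : 'rV[R]_n -> R) :
  Cr 0 setT f -> open [set x | f x != 0].
Proof.
move=> cf; apply: (@open_comp _ _ f [set y | y != 0]) => [x _|].
  exact: cf.
exact: open_neq.
Qed.

(** Invertibility of all blocks becomes the nonvanishing of a single scalar function, to which
    [open_nonzero] applies. *)
Lemma prod_det_neq0 (R : fieldType) (I : finType) (N : I -> nat)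
    (M : forall i, 'M[R]_(N i)) :
  reflect (forall i, M i \in unitmx) (\prod_i \det (M i) != 0).
Proof.
apply: (iffP (prodf_neq0 _ _)) => uM i => [|_]; move: (uM i).
  by rewrite unitmxE unitfE; apply.
by rewrite unitmxE unitfE.
Qed.

(** * Block coordinates on a Euclidean space *)

Section BlockCoordinates.
Context {R : realType} (I : finType) (N : I -> nat) (n : nat).
Variable d : forall i, {linear 'rV[R]_n -> 'M[R]_(N i)}.
Hypothesis d_inj : forall v w, (forall i, d i v = d i w) -> v = w.
Hypothesis d_surj : forall M : (forall i, 'M[R]_(N i)),
  exists v, forall i, d i v = M i.

(** The inverse of the joint map of the [d i], chosen from [d_surj]. Its linearity, a consequence of
    [d_inj], is expressed by [unblock_expand]. *)
Definition unblock (M : forall i, 'M[R]_(N i)) : 'rV[R]_n := sval (cid (d_surj M)).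

Lemma unblockK M i : d i (unblock M) = M i.
Proof. exact: (svalP (cid (d_surj M)) i). Qed.

(* Comparing the indices in [nat] avoids transporting along [i = j]. *)
Lemma unblock_expand M : unblock M = \sum_i \sum_a \sum_b M i a b *:
  unblock (fun j => \matrix_(a', b')
    [&& i == j, a' == a :> nat & b' == b :> nat]%:R).
Proof.
(* In block [j] only the terms with [i = j] survive, and each entry there receives only its own
   summand. *)
apply: d_inj => j; rewrite unblockK linear_sum (bigD1 j) //= [X in _ + X]big1.
  rewrite addr0 linear_sum /=; apply/matrixP => a b; rewrite summxE (bigD1 a) //=.
  rewrite [X in _ + X]big1 => [|a' na]; last first.
    rewrite linear_sum summxE big1 // => b' _.
    rewrite linearZ /= unblockK !mxE eqxx /=.
    by case: eqP => [/val_inj ea|_]; [rewrite ea eqxx in na|rewrite mulr0].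
  rewrite addr0 linear_sum summxE (bigD1 b) //= linearZ /= unblockK !mxE !eqxx mulr1.
  rewrite big1 ?addr0 // => b' nb; rewrite linearZ /= unblockK !mxE !eqxx /=.
  by case: eqP => [/val_inj eb|_]; [rewrite eb eqxx in nb|rewrite mulr0].
move=> i ni; rewrite linear_sum big1 // => a _; rewrite linear_sum big1 // => b _.
rewrite linearZ /= unblockK; apply/matrixP => a' b'; rewrite !mxE.
by rewrite (negbTE ni) mulr0.
Qed.

(** By [unblock_expand], each coordinate is a combination of the entries with constant
    coefficients. *)
Lemma Cr_unblock r m (U : set 'rV[R]_m) (F : 'rV[R]_m -> forall i, 'M[R]_(N i)) :
  open U -> (forall i a b, Cr r U (fun x => F x i a b)) ->
  forall k, Cr r U (fun x => unblock (F x) 0 k).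
Proof.
move=> oU HF k.
have H : Cr r U (fun x => \sum_i \sum_a \sum_b F x i a b *
    unblock (fun j => \matrix_(a', b')
      [&& i == j, a' == a :> nat & b' == b :> nat]%:R) 0 k).
  apply: Cr_sum => // i _; apply: Cr_sum => // a _; apply: Cr_sum => // b _.
  by apply: CrM => //; apply: Cr_cst.
apply: Cr_ext H => // x _; rewrite [in RHS]unblock_expand summxE.
apply: eq_bigr => i _; rewrite summxE; apply: eq_bigr => a _.
by rewrite summxE; apply: eq_bigr => b _; rewrite mxE.
Qed.

Lemma Cr_block r m (U : set 'rV[R]_m) (f : 'rV[R]_m -> 'rV[R]_n) : open U ->
  (forall k, Cr r U (fun x => f x 0 k)) ->
  forall i a b, Cr r U (fun x => d i (f x) a b).
Proof.
move=> oU Hf i a b; apply: (Cr_linear (L := fun v => d i v a b)) => //.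
by move=> c u v; rewrite linearP !mxE.
Qed.

Lemma Cr_block_id r (U : set 'rV[R]_n) i a b : open U ->
  Cr r U (fun x => d i x a b).
Proof. by move=> oU; apply: Cr_block => // k; apply: Cr_coord. Qed.

Section MatrixGroup.
Variable H : forall i j, 'M[R]_(N i, N j).

Definition isometries : set 'rV[R]_n := [set v |
  (forall i, d i v \in unitmx) /\
  forall i j, (d i v)^T *m H i j *m d j v = H i j].

(** The equations are linear in [v], so the solutions are a finite intersection of kernels: the Lie
    algebra of [isometries] and the model space of the slice charts. *)
Lemma Lie_algebra_ex : exists L : {vspace 'rV[R]_n}, forall v,
  v \in L <-> forall i j, (d i v)^T *m H i j + H i j *m d j v = 0.
Proof.
pose F i j v := (d i v)^T *m H i j + H i j *m d j v.
have lF i j : linear (F i j).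
  move=> c u v; rewrite /F !linearP /= mulmxDl -scalemxAl.
  by rewrite scalerDr addrACA.
exists (\bigcap_i \bigcap_j lker (linfun (linear_of (lF i j))))%VS => v.
rewrite memvE; split=> [Lv i j|Hv].
  have : (<[v]> <= lker (linfun (linear_of (lF i j))))%VS.
    by move/subv_bigcapP: Lv => /(_ i isT) /subv_bigcapP /(_ j isT).
  by rewrite -memvE memv_ker lfunE /= => /eqP.
apply/subv_bigcapP => i _; apply/subv_bigcapP => j _.
by rewrite -memvE memv_ker lfunE /=; apply/eqP; apply: Hv.
Qed.

(** Left translation by [x0] moves the chart at the identity to [x0], so the same subspace [L]
    serves at every point. *)
Lemma isometries_submanifold : exists e, embedded_submanifold e isometries.
Proof.
have [L LP] := Lie_algebra_ex.
exists (\dim L) => x0 [ux0 Hx0].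
pose M v i := invmx (d i x0) *m d i v.
pose phi v := unblock (fun i => cayley (M v i)).
pose psi w := unblock (fun i => d i x0 *m cayley_inv (d i w)).
(* Besides [M + 1], the block [M] itself must be invertible: the linear condition yields only the
   form equations, whereas [isometries] also asks for units. As [1 + X = M (1 - X)], this
   corresponds in [W] to the invertibility of [1 + X]. *)
pose fU v := (\prod_i \det (M v i + 1%:M)) * \prod_i \det (M v i).
pose fW w := (\prod_i \det (1%:M - d i w)) * \prod_i \det (1%:M + d i w).
pose U := [set v | fU v != 0].
pose W := [set w | fW w != 0].
have UP v : U v <-> (forall i, M v i + 1%:M \in unitmx) /\ (forall i, M v i \in unitmx).
  rewrite /U /= /fU mulf_eq0 negb_or; split=> [/andP[]|[h1 h2]].
    by move=> /prod_det_neq0 ? /prod_det_neq0.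
  by apply/andP; split; apply/prod_det_neq0.
have WP w : W w <-> (forall i, 1%:M - d i w \in unitmx) /\ (forall i, 1%:M + d i w \in unitmx).
  rewrite /W /= /fW mulf_eq0 negb_or; split=> [/andP[]|[h1 h2]].
    by move=> /prod_det_neq0 ? /prod_det_neq0.
  by apply/andP; split; apply/prod_det_neq0.
have CrM1 r (O : set 'rV[R]_n) i : open O -> forall a b, Cr r O (fun v => M v i a b).
  move=> oO; apply: Cr_mulmx => // a b; first exact: Cr_cst.
  exact: Cr_block_id.
have CrMD r (O : set 'rV[R]_n) i : open O ->
    forall a b, Cr r O (fun v => (M v i + 1%:M) a b).
  by move=> oO; apply: Cr_addmx => // a b; [apply: CrM1|apply: Cr_cst].
have CrMB r (O : set 'rV[R]_n) i : open O ->
    forall a b, Cr r O (fun v => (M v i - 1%:M) a b).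
  by move=> oO; apply: Cr_addmx => // a b; [apply: CrM1|apply: Cr_cst].
have CrXD r (O : set 'rV[R]_n) i : open O ->
    forall a b, Cr r O (fun w => (1%:M + d i w) a b).
  by move=> oO; apply: Cr_addmx => // a b; [apply: Cr_cst|apply: Cr_block_id].
have CrXB r (O : set 'rV[R]_n) i : open O ->
    forall a b, Cr r O (fun w => (1%:M - d i w) a b).
  move=> oO; apply: Cr_addmx => // a b; first exact: Cr_cst.
  by apply: Cr_oppmx => // a' b'; apply: Cr_block_id.
have oT := @openT 'rV[R]_n.
have oU : open U.
  apply: open_nonzero; apply: CrM => //; apply: Cr_prod => // i _; apply: Cr_det => // a b.
    exact: CrMD.
  exact: CrM1.
have oW : open W.
  apply: open_nonzero; apply: CrM => //; apply: Cr_prod => // i _; apply: Cr_det => // a b.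
    exact: CrXB.
  exact: CrXD.
have x0M i v : d i x0 *m M v i = d i v by rewrite /M mulKVmx ?ux0.
have phiE v i : d i (phi v) = cayley (M v i) by rewrite unblockK.
have psiE w i : M (psi w) i = cayley_inv (d i w) by rewrite /M unblockK mulKmx ?ux0.
exists U, W, phi, psi, L; split=> //.
(* At [x0] the translated blocks are the identity, so [M + 1] is the scalar matrix 2. *)
- apply/UP; split=> i; rewrite /M mulVmx ?ux0 ?unitmx1 //.
  by rewrite -raddfD unitmx_two.
- split=> //.
  + apply/smooth_onP => // r; apply: Cr_unblock => // i a b.
    apply: Cr_mulmx => // a' b'; first exact: CrMB.
    apply: Cr_invmx => //.
      by move=> v /UP[uM1 _]; apply: uM1.
    by move=> *; apply: CrMD.
  + apply/smooth_onP => // r; apply: Cr_unblock => // i a b.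
    apply: Cr_mulmx => // a' b'; first exact: Cr_cst.
    apply: Cr_mulmx => // {}a' {}b'; first exact: CrXD.
    apply: Cr_invmx => //.
      by move=> w /WP[uX _]; apply: uX.
    by move=> *; apply: CrXB.
  + move=> v /UP[uM1 uM]; split.
      apply/WP; split=> i; rewrite phiE; first by rewrite cayley_unit ?uM1.
      by rewrite cayleyD ?uM1 // unitmx_mul uM cayley_unit ?uM1.
    by apply: d_inj => i; rewrite unblockK phiE cayleyK ?uM1 ?x0M.
  + move=> w /WP[uX uX1]; split.
      apply/UP; split=> i; rewrite psiE; first by rewrite cayley_inv_unit ?uX.
      by rewrite unitmx_mul uX1 unitmx_inv uX.
    by apply: d_inj => i; rewrite phiE psiE cayley_invK ?uX.
- move=> v /UP[uM1 uM]; rewrite LP.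
  (* Since [x0] preserves the forms, [x0 M] pulls them back in the same way as [M]. *)
  have E i j : (d i v)^T *m H i j *m d j v = (M v i)^T *m H i j *m M v j.
    rewrite -(x0M i) -(x0M j) trmx_mul -[in RHS](Hx0 i j) !mulmxA.
    by rewrite -!mulmxA.
  split=> [[_ Hv] i j|Hv].
    by rewrite !phiE -cayley_isometry ?uM1 // -E.
  split=> [i|i j]; first by rewrite -(x0M i) unitmx_mul ux0 uM.
  by rewrite E cayley_isometry ?uM1 // -!phiE.
Qed.

End MatrixGroup.
End BlockCoordinates.

(** * A criterion for Lie groups of block matrices *)

Section MatrixLieGroup.
Context {R : realType} (G : embedded_group R) (I : finType) (N : I -> nat).
Variable H : forall i j, 'M[R]_(N i, N j).
Variable rho : forall i, eg_type G -> 'M[R]_(N i).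
Variable d : forall i, {linear 'rV[R]_(eg_dim G) -> 'M[R]_(N i)}.
Hypothesis d_coord : forall i x, d i (eg_coord x) = rho i x.
Hypothesis d_inj : forall v w, (forall i, d i v = d i w) -> v = w.
Hypothesis rho_inj : forall x y, (forall i, rho i x = rho i y) -> x = y.
Hypothesis rho_surj : forall M : (forall i, 'M[R]_(N i)),
  exists x, forall i, rho i x = M i.
Hypothesis rho1 : forall i, rho i (@eg_one R G) = 1%:M.
Hypothesis rhoM : forall i x y, rho i (eg_mul x y) = rho i x *m rho i y.
Hypothesis rhoV : forall i x, eg_set x -> rho i (eg_inv x) = invmx (rho i x).
Hypothesis setP : forall x : eg_type G, eg_set x <->
  (forall i, rho i x \in unitmx) /\
  forall i j, (rho i x)^T *m H i j *m rho j x = H i j.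

(** The group laws are checked through the jointly faithful maps [rho]. By [rho_surj] every block
    family comes from an element of the type, so the image of the group in coordinates is all of
    [isometries]. *)
Lemma matrix_group_is_lie : is_lie_group G.
Proof.
have d_surj (M : forall i, 'M[R]_(N i)) : exists v, forall i, d i v = M i.
  by have [x xM] := rho_surj M; exists (eg_coord x) => i; rewrite d_coord xM.
split.
- split.
  + split=> [|x _]; last by split; apply: rho_inj => i; rewrite rhoM rho1 ?mul1mx ?mulmx1.
    by apply/setP; split=> [i|i j]; rewrite !rho1 ?unitmx1 // trmx1 mul1mx mulmx1.
  + move=> x y /setP[ux Hx] /setP[uy Hy]; apply/setP; split=> [i|i j].
      by rewrite rhoM unitmx_mul ux uy.
    rewrite !rhoM trmx_mul -[RHS]Hy -[in RHS](Hx i j) !mulmxA.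
    by [].
  + move=> x Sx; have /setP[ux Hx] := Sx; split.
    * apply/setP; split=> [i|i j]; first by rewrite rhoV // unitmx_inv ux.
      (* Replacing [H i j] by its pullback along [x] lets the inverse factors cancel. *)
      rewrite !rhoV // -[in LHS](Hx i j) trmx_inv !mulmxA mulVmx ?unitmx_tr ?ux //.
      by rewrite mul1mx mulmxK ?ux.
    * by apply: rho_inj => i; rewrite rhoM rhoV // rho1 mulVmx ?ux.
    * by apply: rho_inj => i; rewrite rhoM rhoV // rho1 mulmxV ?ux.
  + by move=> x y z _ _ _; apply: rho_inj => i; rewrite !rhoM mulmxA.
- by move=> x y _ _ E; apply: rho_inj => i; rewrite -!d_coord E.
- have [e he] := isometries_submanifold d_inj d_surj H; exists e.
  suff -> : @eg_coord R G @` @eg_set R G = isometries d H by [].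
  apply/seteqP; split=> [_ [x /setP[ux Hx] <-]|v [uv Hv]].
    by split=> [i|i j]; rewrite !d_coord ?ux ?Hx.
  have [x xM] := rho_surj (fun i => d i v).
  exists x; last by apply: d_inj => i; rewrite d_coord xM.
  by apply/setP; split=> [i|i j]; rewrite !xM ?uv ?Hv.
(* Multiplication is polynomial in the blocks, so one extension serves on the whole space. *)
- move=> u _; exists setT, (fun v => unblock d_surj (fun i => d i (lsubmx v) *m d i (rsubmx v))).
  split=> //; first exact: openT.
    apply/smooth_onP; first exact: openT.
    move=> r; apply: Cr_unblock => //; first exact: openT.
    move=> i a b; apply: Cr_mulmx => [|a' b'|a' b']; first exact: openT.
      apply: Cr_block => [|k]; first exact: openT.
      apply: Cr_ext (Cr_coord r _ (lshift _ k)) => [|x _]; first exact: openT.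
      by rewrite mxE.
    apply: Cr_block => [|k]; first exact: openT.
    apply: Cr_ext (Cr_coord r _ (rshift _ k)) => [|x _]; first exact: openT.
    by rewrite mxE.
  move=> y _ _; apply: d_inj => i; rewrite unblockK d_coord rhoM.
  by rewrite row_mxKl row_mxKr !d_coord.
- move=> x Sx; have /setP[ux _] := Sx.
  (* Inversion extends to the open set where every block is invertible. *)
  pose U := [set v : 'rV[R]_(eg_dim G) | \prod_i \det (d i v) != 0].
  have oU : open U.
    apply: open_nonzero; apply: Cr_prod => [|i _]; first exact: openT.
    apply: Cr_det => [|a b]; first exact: openT.
    by apply: Cr_block_id; exact: openT.
  exists U, (fun v => unblock d_surj (fun i => invmx (d i v))); split=> //.
  + by apply/prod_det_neq0 => i; rewrite d_coord ux.
  + apply/smooth_onP => // r; apply: Cr_unblock => // i a b.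
    apply: Cr_invmx => // [v /prod_det_neq0|a' b'] //.
    exact: Cr_block_id.
  + by move=> y Sy _; apply: d_inj => i; rewrite unblockK !d_coord rhoV.
Qed.

End MatrixLieGroup.

(** * Endomorphisms, forms and families in coordinates *)

Lemma linear_form_sum (R : realType) (W : lmodType R) (L : W -> R)
    (lL : linear (L : W -> R^o)) (I : finType) (x : I -> R) (u : I -> W) :
  L (\sum_i x i *: u i) = \sum_i x i * L (u i).
Proof.
have E v : L v = linear_of lL v by [].
rewrite E linear_sum; apply: eq_bigr => i _.
by rewrite linearZ_LR.
Qed.

Section MatrixInBasis.
Context {R : realType} (W : vectType R) (n : nat) (b : n.-tuple W).
Hypothesis b_basis : basis_of {:W} b.
Implicit Types f g : 'End(W).

Lemma basis_expand v : v = \sum_a coord b a v *: tnth b a.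
Proof.
rewrite [LHS](coord_basis b_basis (memvf v)).
by apply: eq_bigr => a _; rewrite (tnth_nth 0).
Qed.

Lemma lfun_basis_expand f v : f v = \sum_a coord b a v *: f (tnth b a).
Proof.
rewrite {1}(basis_expand v) linear_sum.
by apply: eq_bigr => a _; rewrite linearZ.
Qed.

Lemma coord_tnth a c : coord b c (tnth b a) = (c == a)%:R.
Proof. by rewrite (tnth_nth 0) coord_free ?(basis_free b_basis) // eq_sym. Qed.

Lemma matrix_in_basis_expand f a :
  f (tnth b a) = \sum_c matrix_in_basis b f c a *: tnth b c.
Proof. by rewrite [LHS]basis_expand; apply: eq_bigr => c _; rewrite mxE. Qed.

Lemma matrix_in_basis_linear : linear (matrix_in_basis b).
Proof. by move=> c f g; apply/matrixP => i j; rewrite !mxE !lfunE /= lfunE /= linearP. Qed.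

Lemma matrix_in_basis1 : matrix_in_basis b \1%VF = 1%:M.
Proof. by apply/matrixP => c a; rewrite !mxE lfunE /= coord_tnth. Qed.

Lemma matrix_in_basisM f g :
  matrix_in_basis b (f \o g)%VF = matrix_in_basis b f *m matrix_in_basis b g.
Proof.
apply/matrixP => c a; rewrite mxE comp_lfunE matrix_in_basis_expand !linear_sum mxE.
by apply: eq_bigr => d _; rewrite !linearZ /= mulrC; congr (_ * _); rewrite mxE.
Qed.

Lemma matrix_in_basis_inj : injective (matrix_in_basis b).
Proof.
move=> f g E; apply/lfunP => v; rewrite (basis_expand v) !linear_sum /=.
by apply: eq_bigr => a _; rewrite !linearZ /= !matrix_in_basis_expand E.
Qed.

Definition hom_of_matrix (M : 'M[R]_n) : 'End(W) :=
  linfun (fun v => \sum_a coord b a v *: \sum_c M c a *: tnth b c).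

Lemma hom_of_matrixE M v :
  hom_of_matrix M v = \sum_a coord b a v *: \sum_c M c a *: tnth b c.
Proof.
have lf : linear (fun v => \sum_a coord b a v *: \sum_c M c a *: tnth b c).
  move=> c u w; rewrite scaler_sumr -big_split /=; apply: eq_bigr => a _.
  by rewrite linearP scalerDl scalerA.
exact: (lfunE (linear_of lf)).
Qed.

Lemma hom_of_matrix_tnth M a : hom_of_matrix M (tnth b a) = \sum_c M c a *: tnth b c.
Proof.
rewrite hom_of_matrixE (bigD1 a) //= coord_tnth eqxx scale1r [X in _ + X]big1 ?addr0 // => c nc.
by rewrite coord_tnth (negbTE nc) scale0r.
Qed.

Lemma hom_of_matrixK M : matrix_in_basis b (hom_of_matrix M) = M.
Proof.
apply/matrixP => c a; rewrite mxE hom_of_matrix_tnth linear_sum (bigD1 c) //=.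
rewrite linearZ /= coord_tnth eqxx mulr1 [X in _ + X]big1 ?addr0 // => e ne.
by rewrite linearZ /= coord_tnth eq_sym (negbTE ne) mulr0.
Qed.

(** This is the inverse of the linear bijection [matrix_in_basis b]. *)
Lemma hom_of_matrix_linear : linear hom_of_matrix.
Proof.
move=> c M M'; apply: matrix_in_basis_inj.
by rewrite matrix_in_basis_linear !hom_of_matrixK.
Qed.

(** An injective endomorphism in finite dimension is bijective; a zero kernel is the condition under
    which [f^-1] is a two-sided inverse. *)
Lemma bijective_lker0 f : bijective f <-> lker f == 0%VS.
Proof.
split=> [/bij_inj /lker0P //|k0].
by exists (f^-1)%VF; [exact: lker0_lfunK|exact: lker0_lfunVK].
Qed.

Lemma matrix_in_basis_unit f : bijective f <-> matrix_in_basis b f \in unitmx.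
Proof.
split=> [/bijective_lker0 k0|uM].
  have := lker0_compVf k0 => /(congr1 (matrix_in_basis b)).
  by rewrite matrix_in_basisM matrix_in_basis1 => /mulmx1_unit [].
exists (hom_of_matrix (invmx (matrix_in_basis b f))) => v.
  rewrite -comp_lfunE -[RHS]id_lfunE; congr (fun_of_lfun _ v).
  apply: matrix_in_basis_inj.
  by rewrite matrix_in_basisM hom_of_matrixK matrix_in_basis1 mulVmx.
rewrite -comp_lfunE -[RHS]id_lfunE; congr (fun_of_lfun _ v).
apply: matrix_in_basis_inj.
by rewrite matrix_in_basisM hom_of_matrixK matrix_in_basis1 mulmxV.
Qed.

Lemma matrix_in_basisV f : bijective f ->
  matrix_in_basis b (f^-1)%VF = invmx (matrix_in_basis b f).
Proof.
move=> bf; have uM := (matrix_in_basis_unit f).1 bf.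
apply: (can_inj (mulKmx uM)); rewrite mulmxV // -matrix_in_basisM.
by rewrite lker0_compfV ?matrix_in_basis1 //; apply/bijective_lker0.
Qed.

End MatrixInBasis.

(** * Gram matrices and isometries *)

Section Gram.
Context {R : realType} (U W : vectType R) (m n : nat).
Variables (bU : m.-tuple U) (bW : n.-tuple W).
Hypotheses (bU_basis : basis_of {:U} bU) (bW_basis : basis_of {:W} bW).
Variable h : U -> W -> R.
Hypothesis h_bilin : bilinear_for *%R *%R h.

Lemma bilin_sum (I J : finType) (x : I -> R) (u : I -> U) (y : J -> R) (w : J -> W) :
  h (\sum_i x i *: u i) (\sum_j y j *: w j) = \sum_i \sum_j x i * (h (u i) (w j) * y j).
Proof.
have l1 w' : linear (fun u' => h u' w' : R^o) by move=> c u1 u2; apply: h_bilin.1.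
have l2 u' : linear (fun w' => h u' w' : R^o) by move=> c w1 w2; apply: h_bilin.2.
rewrite (linear_form_sum (l1 _)); apply: eq_bigr => i _.
rewrite (linear_form_sum (l2 _)) mulr_sumr; apply: eq_bigr => j _.
by rewrite [y j * _]mulrC.
Qed.

Definition gram : 'M[R]_(m, n) := \matrix_(a, c) h (tnth bU a) (tnth bW c).

Lemma gram_comp (f : 'End(U)) (k : 'End(W)) :
  (matrix_in_basis bU f)^T *m gram *m matrix_in_basis bW k =
  \matrix_(a, c) h (f (tnth bU a)) (k (tnth bW c)).
Proof.
apply/matrixP => a c; rewrite -mulmxA mxE [RHS]mxE.
rewrite [in RHS](matrix_in_basis_expand bU_basis) [in RHS](matrix_in_basis_expand bW_basis).
rewrite bilin_sum; apply: eq_bigr => a' _; rewrite [_^T _ _]mxE [(_ *m _) _ _]mxE mulr_sumr.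
by apply: eq_bigr => c' _; rewrite [gram _ _]mxE.
Qed.

(** By [gram_comp] the product is the Gram matrix of the transformed form, and a bilinear form is
    determined by its values on pairs of basis vectors. This links invariance of [g] to the
    equations of [isometries]. *)
Lemma isometryP (f : 'End(U)) (k : 'End(W)) :
  (matrix_in_basis bU f)^T *m gram *m matrix_in_basis bW k = gram <->
  forall u w, h (f u) (k w) = h u w.
Proof.
rewrite gram_comp; split=> [/matrixP E u w|E]; last first.
  by apply/matrixP => a c; rewrite !mxE E.
rewrite (lfun_basis_expand bU_basis f u) (lfun_basis_expand bW_basis k w).
rewrite [in RHS](basis_expand bU_basis u) [in RHS](basis_expand bW_basis w).
rewrite !bilin_sum; apply: eq_bigr => a _; apply: eq_bigr => c _.
by have := E a c; rewrite !mxE => ->.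
Qed.

End Gram.

(** * Extension of dependent families by default values *)

Section Extend.
Variables (I : Type) (J : eqType) (T : J -> Type) (idx : I -> J).
Variable def : forall j, T j.

(** The value [a i] lives in [T (idx i)]; the transport along [e] carries it to [T j]. *)
Definition extend (a : forall i, T (idx i)) (j : J) : T j :=
  match pselect (exists i, idx i = j) with
  | left H => let: exist i e := cid H in eq_rect (idx i) T (a i) j e
  | right _ => def j
  end.

Lemma extendE a i : injective idx -> extend a (idx i) = a i.
Proof.
move=> idx_inj; rewrite /extend; case: pselect => [H|[]]; last by exists i.
case: cid => i' e; have ii := idx_inj _ _ e; subst i'.
(* Equality proofs in an [eqType] are unique, so the transport is trivial. *)
by rewrite (eq_irrelevance e erefl).
Qed.

End Extend.

(** The preimage of [j] is chosen independently of the family, hence is the same for [a], [b] and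
    [c]. *)
Lemma extend_linear (R : pzRingType) (I : Type) (J : eqType) (T : J -> lmodType R)
    (idx : I -> J) (a b c : forall i, T (idx i)) (x : R) j :
  (forall i, c i = x *: a i + b i) ->
  extend (fun j => 0 : T j) c j =
  x *: extend (fun j => 0 : T j) a j + extend (fun j => 0 : T j) b j.
Proof.
move=> ce; rewrite /extend; case: pselect => [H|_]; last by rewrite scaler0 addr0.
by case: cid => i e; case: j / e {H} => /=; apply: ce.
Qed.

(** * The two Lie groups *)

Lemma dim0_all0 (R : realType) (W : vectType R) : \dim {:W} = 0%N ->
  forall v : W, v = 0.
Proof.
move=> /eqP; rewrite dimv_eq0 => /eqP W0 v.
by apply/eqP; rewrite -memv0 -W0 memvf.
Qed.

Lemma bilin0 (R : realType) (U W : vectType R) (h : U -> W -> R) :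
  bilinear_for *%R *%R h -> (forall w, h 0 w = 0) /\ (forall u, h u 0 = 0).
Proof.
move=> hb; split=> [w|u].
  have l1 : linear (fun u' => h u' w : R^o) by move=> c u1 u2; apply: hb.1.
  exact: (linear0 (linear_of l1)).
have l2 : linear (fun w' => h u w' : R^o) by move=> c w1 w2; apply: hb.2.
exact: (linear0 (linear_of l2)).
Qed.

(* Makes the linear structures of [v2r] and [r2v] available. *)
Import VectorInternalTheory.

Lemma r2v_linear (R : realType) (W : vectType R) :
  linear (@r2v R W).
Proof. exact: linearP. Qed.

Lemma v2r_linear (R : realType) (W : vectType R) : linear (@v2r R W).
Proof. exact: linearP. Qed.

(** * The graded orthogonal group *)

Section GradedOrthogonal.
Context {R : realType} (V : gradedVect R) (l : int) (g : gform V).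
Arguments g : clear implicits.
Hypothesis gmetric : is_metric l g.

(** [linfun] has the values of its argument once that argument is linear, here by linearity of [g]
    in its second variable. *)
Lemma gflatE j (v : V j) w :
  gflat l g v w = (-1) ^ ((j + 1) * l) * g j (- (j + l)) v w.
Proof.
have [gb _ _ _] := gmetric.
have lf : linear (fun w => (-1) ^ ((j + 1) * l) * g j (- (j + l)) v w : R^o).
  move=> c w1 w2; rewrite (gb _ _).2 mulrDr; congr (_ + _).
  by rewrite mulrCA.
exact: (lfunE (linear_of lf)).
Qed.

(** [gflat] tests exactly the degrees with [i + j + l = 0], outside of which [g] vanishes; its sign
    is a nonzero factor common to both sides. *)
Lemma is_OP (A : gEnd V) : is_O l g A <->
  is_GL A /\ forall i j v w, g i j (A i v) (A j w) = g i j v w.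
Proof.
have [_ gdeg _ _] := gmetric.
split=> -[GA HA]; split=> //.
  move=> i j v w; have [ijl|ijl] := eqVneq (i + j + l) 0; last first.
    by rewrite !gdeg.
  have ej : j = - (i + l) by apply/eqP; rewrite -addr_eq0 addrA [j + i]addrC ijl.
  subst j; have := HA i v => /(congr1 (fun xi => fun_of_lfun xi w)).
  rewrite /gdual_map comp_lfunE !gflatE.
  by apply: mulfI; rewrite expfz_neq0 // oppr_eq0 oner_eq0.
move=> j v; apply/lfunP => w.
by rewrite /gdual_map comp_lfunE !gflatE HA.
Qed.

Definition deg (i : 'I_(gv_bound V).*2.+1) : int := i%:Z - (gv_bound V)%:Z.

Lemma deg_inj : injective deg.
Proof. by move=> i j /addIr [] /val_inj. Qed.

Lemma deg_cover j : (exists i, deg i = j) \/ (forall v : V j, v = 0).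
Proof.
have [lt|le] := ltnP (gv_bound V) `|j|%N.
  by right; apply: dim0_all0; apply: gv_boundP.
left; have lti : (absz (j + (gv_bound V)%:Z)%R < (gv_bound V).*2.+1)%N by lia.
by exists (Ordinal lti); rewrite /deg /=; lia.
Qed.

(** The Lie group structure is established in the arbitrary bases [vbasis]; the standard total basis
    enters only in the comparison with the product. *)
Definition graded_matrix i (A : gEnd V) : 'M[R]_(\dim {:V (deg i)}) :=
  matrix_in_basis (vbasis {:V (deg i)}) (A (deg i)).

Definition graded_block i (v : 'rV[R]_(eg_dim (O_group l g))) :
    'M[R]_(\dim {:V (deg i)}) :=
  matrix_in_basis (vbasis {:V (deg i)}) (r2v (submxrow v i)).

Lemma graded_block_linear i : linear (graded_block i).
Proof.
move=> c v w; rewrite /graded_block.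
have -> : submxrow (c *: v + w) i = c *: submxrow v i + submxrow w i.
  by apply/matrixP => a b; rewrite !mxE.
by rewrite r2v_linear matrix_in_basis_linear.
Qed.

Lemma graded_block_coord i (A : gEnd V) :
  graded_block i (@eg_coord R (O_group l g) A) = graded_matrix i A.
Proof.
rewrite /graded_block /graded_matrix; congr matrix_in_basis.
by rewrite /= /gEnd_coord mxrowK v2rK.
Qed.

Lemma gEnd_eq (A B : gEnd V) : (forall i, A (deg i) = B (deg i)) -> A = B.
Proof.
move=> AB; apply: functional_extensionality_dep => j.
have [[i <-]|V0] := deg_cover j; first exact: AB.
by apply/lfunP => v; rewrite (V0 v) !linear0.
Qed.

(** The forms are the Gram matrices of [g] for all pairs of degrees; those with [deg i + deg j + l]
    nonzero vanish and impose nothing. *)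
Lemma O_group_is_lie : is_lie_group (O_group l g).
Proof.
have [gb gdeg _ _] := gmetric.
have vb j := vbasisP {:V j}.
pose H i j := gram (vbasis {:V (deg i)}) (vbasis {:V (deg j)}) (g (deg i) (deg j)).
apply: (@matrix_group_is_lie R (O_group l g) _ _ H graded_matrix
  (fun i => linear_of (graded_block_linear i))).
- exact: graded_block_coord.
- move=> v w E; apply/mxrowP => i.
  apply: (can_inj (@r2vK _ _)).
  exact: (matrix_in_basis_inj (vb _) (E i)).
- move=> A B E; apply: gEnd_eq => i.
  exact: (matrix_in_basis_inj (vb _) (E i)).
- move=> M; exists (extend (fun j => 0 : 'End(V j))
    (fun i => hom_of_matrix (vbasis {:V (deg i)}) (M i))) => i.
  by rewrite /graded_matrix extendE ?hom_of_matrixK //; apply: deg_inj.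
- by move=> i; apply: matrix_in_basis1.
- by move=> i A B; apply: matrix_in_basisM.
- by move=> i A [GA _]; apply: matrix_in_basisV.
- move=> A; rewrite /= is_OP; split=> -[GA HA]; split=> [i|i j].
  + by apply/matrix_in_basis_unit.
  + by apply/isometryP.
  (* In the degrees that [deg] misses the space is zero, so bijectivity, and below it invariance,
     are trivial. *)
  + have [[i' <-]|V0] := deg_cover i; first exact/(matrix_in_basis_unit (vb _)).
    by exists id => v; rewrite (V0 v) ?linear0 // V0.
  + have z i' j' := bilin0 (gb i' j').
    have [[i' <-]|V0] := deg_cover i; last by move=> v w; rewrite (V0 v) linear0 !(z _ _).1.
    have [[j' <-]|V0'] := deg_cover j; last by move=> v w; rewrite (V0' w) linear0 !(z _ _).2.
    exact/(isometryP (vb _) (vb _) (gb _ _)).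
Qed.

End GradedOrthogonal.

(** * The product group *)

Section Product.
Context {R : realType} (p q n : nat) (r : 'I_n -> nat).

Definition prod_group : embedded_group R :=
  lie_prod (Opq p q) (lie_bigprod (fun i : 'I_n => GLn (r i))).

(** [None] indexes the indefinite orthogonal factor and [Some i] the general linear ones. *)
Definition prod_size (o : option 'I_n) : nat := if o is Some i then r i else (p + q)%N.

Definition prod_matrix o (y : eg_type prod_group) : 'M[R]_(prod_size o) :=
  match o with None => y.1 | Some i => y.2 i end.

Definition prod_block o (v : 'rV[R]_(eg_dim prod_group)) : 'M[R]_(prod_size o) :=
  match o with
  | None => vec_mx (lsubmx v)
  | Some i => vec_mx (submxrow (rsubmx v) i)
  end.

Lemma prod_block_linear o : linear (prod_block o).
Proof. by case: o => [i|] c v w; apply/matrixP => a b; rewrite !mxE. Qed.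

Lemma prod_block_coord o (y : eg_type prod_group) :
  prod_block o (eg_coord y) = prod_matrix o y.
Proof.
case: o => [i|] /=; first by rewrite row_mxKr mxrowK mxvecK.
by rewrite row_mxKl mxvecK.
Qed.

Lemma prod_block_inj v w : (forall o, prod_block o v = prod_block o w) -> v = w.
Proof.
move=> E; rewrite -(hsubmxK v) -(hsubmxK w); congr row_mx.
  exact: (can_inj vec_mxK (E None)).
by apply/mxrowP => i; apply: (can_inj vec_mxK (E (Some i))).
Qed.

Lemma eta_sqr : Defs.eta p q *m Defs.eta p q = 1%:M :> 'M[R]_(p + q).
Proof.
rewrite /eta mulmx_block !(mulmx1, mulmx0, mul0mx, addr0, add0r) mulNmx mulmxN.
by rewrite mul1mx opprK -scalar_mx_block.
Qed.

(** Since [eta] is its own inverse, [eta M^T eta] is a left inverse of [M]. *)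
Lemma Opq_unit (M : 'M[R]_(p + q)) : M^T *m Defs.eta p q *m M = Defs.eta p q -> M \in unitmx.
Proof.
move=> HM; have : Defs.eta p q *m M^T *m Defs.eta p q *m M = 1%:M.
  by rewrite -!mulmxA [M^T *m _]mulmxA HM eta_sqr.
by move/mulmx1_unit => [].
Qed.

(** The only nonzero form is [eta], on the first factor; on the others the zero forms leave
    invertibility as the sole condition. *)
Lemma prod_group_is_lie : is_lie_group prod_group.
Proof.
pose H o o' : 'M[R]_(prod_size o, prod_size o') :=
  match o, o' with None, None => Defs.eta p q | _, _ => 0 end.
apply: (@matrix_group_is_lie R prod_group _ _ H prod_matrix
  (fun o => linear_of (prod_block_linear o))).
- by move=> o y; apply: prod_block_coord.
- exact: prod_block_inj.
- move=> [y1 y2] [z1 z2] E; congr pair; first exact: (E None).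
  by apply: functional_extensionality_dep => i; apply: (E (Some i)).
- by move=> M; exists (M None, fun i => M (Some i)) => -[].
- by case.
- by case.
- by case.
- move=> [y1 y2]; split=> [[H1 H2]|[U HH]].
    split=> [[i|]|[i|] [j|]]; rewrite /= ?mulmx0 ?mul0mx //; first exact: (H2 i).
    exact: Opq_unit.
  by split=> [|i]; [exact: (HH None None)|exact: (U (Some i))].
Qed.

End Product.

(** * The isomorphism *)

Section SmoothWrt.
Context {R : realType}.

Lemma Cr_sub (V : normedModType R) r (U U' : set V) (f : V -> R) :
  U' `<=` U -> Cr r U f -> Cr r U' f.
Proof.
move=> sU; elim: r f => [|r IH] f /=; first by move=> cf x /sU; apply: cf.
by move=> [df Df]; split=> [x /sU|v]; [apply: df|apply: IH].
Qed.

Context (T : Type) (n : nat) (X : set T) (c : T -> 'rV[R]_n).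

Lemma smooth_wrt_id : smooth_wrt X c c.
Proof.
move=> x _; exists setT, id; split=> //; first exact: openT.
by apply/smooth_onP => [|r i]; [exact: openT|exact: Cr_coord].
Qed.

Lemma smooth_wrt_add m (d1 d2 : T -> 'rV[R]_m) :
  smooth_wrt X c d1 -> smooth_wrt X c d2 -> smooth_wrt X c (fun x => d1 x + d2 x).
Proof.
move=> s1 s2 x Xx; have [U1 [h1 [V1 U1x sh1 e1]]] := s1 x Xx.
have [U2 [h2 [V2 U2x sh2 e2]]] := s2 x Xx.
have oU : open (U1 `&` U2) by exact: openI.
exists (U1 `&` U2), (fun v => h1 v + h2 v); split=> //; last first.
  by move=> y Xy [U1y U2y]; rewrite e1 // e2.
apply/smooth_onP => // r i.
have H1 := Cr_sub (@subIsetl _ U1 U2) ((smooth_onP _ V1).1 sh1 r i).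
have H2 := Cr_sub (@subIsetr _ U1 U2) ((smooth_onP _ V2).1 sh2 r i).
by apply: Cr_ext (CrD oU H1 H2) => // v _; rewrite mxE.
Qed.

Lemma smooth_wrt_linear m p (L : 'rV[R]_m -> 'rV[R]_p) (d : T -> 'rV[R]_m) :
  linear L -> smooth_wrt X c d -> smooth_wrt X c (fun x => L (d x)).
Proof.
move=> lL s x Xx; have [U [h [Uo Ux sh e]]] := s x Xx.
exists U, (fun v => L (h v)); split=> //; last by move=> y Xy Uy; rewrite e.
apply/smooth_onP => // r i.
apply: (Cr_linear (L := fun v => L v 0 i)) => //; last first.
  exact: (smooth_onP _ Uo).1.
by move=> a u v; rewrite lL !mxE.
Qed.

End SmoothWrt.

Lemma smooth_wrt_eq (R : realType) (T : Type) n m (X : set T)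
    (c : T -> 'rV[R]_n) (d d' : T -> 'rV[R]_m) :
  (forall x, X x -> d x = d' x) -> smooth_wrt X c d -> smooth_wrt X c d'.
Proof.
move=> dd s x Xx; have [U [h [Uo Ux sh e]]] := s x Xx.
by exists U, h; split=> // y Xy Uy; rewrite -dd // e.
Qed.

(** The linear combination is prescribed degree by degree, as a relation between three families. *)
Lemma gEnd_coord_linear (R : realType) (V : gradedVect R) (A B C : gEnd V) (c : R) :
  (forall j, C j = c *: A j + B j) ->
  gEnd_coord C = c *: gEnd_coord A + gEnd_coord B.
Proof.
move=> CE; apply/mxrowP => i.
have -> : submxrow (c *: gEnd_coord A + gEnd_coord B) i
    = c *: submxrow (gEnd_coord A) i + submxrow (gEnd_coord B) i.
  by apply/matrixP => a b; rewrite !mxE.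
by rewrite !mxrowK CE v2r_linear.
Qed.

Lemma prod_coord_linear (R : realType) (p q n : nat) (r : 'I_n -> nat)
    (x y z : eg_type (@prod_group R p q n r)) (c : R) :
  (forall o, prod_matrix o z = c *: prod_matrix o x + prod_matrix o y) ->
  @eg_coord R (prod_group p q r) z = c *: eg_coord x + eg_coord y.
Proof.
move=> zE; apply: prod_block_inj => o.
by rewrite prod_block_linear !prod_block_coord.
Qed.

Section Decode.
Context {R : realType} (V : gradedVect R) (l : int) (g : gform V).

(** A linear left inverse of [gEnd_coord], defined on the whole coordinate space; it presents maps
    out of the group as functions of coordinates. *)
Definition gEnd_decode (v : 'rV[R]_(eg_dim (O_group l g))) : gEnd V :=
  extend (fun j => 0 : 'End(V j)) (fun i : 'I_(gv_bound V).*2.+1 =>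
    r2v (submxrow v i) : 'End(V (deg i))).

Lemma gEnd_decodeK (A : gEnd V) : gEnd_decode (@eg_coord R (O_group l g) A) = A.
Proof.
apply: gEnd_eq => i; rewrite /gEnd_decode extendE; last exact: deg_inj.
by rewrite /= /gEnd_coord mxrowK v2rK.
Qed.

Lemma gEnd_decode_linear c v w j :
  gEnd_decode (c *: v + w) j = c *: gEnd_decode v j + gEnd_decode w j.
Proof.
apply: (extend_linear (T := fun j => 'End(V j))) => i.
have -> : submxrow (c *: v + w) i = c *: submxrow v i + submxrow w i.
  by apply/matrixP => a b; rewrite !mxE.
by rewrite r2v_linear.
Qed.

End Decode.

(** * Matrix blocks in the standard total basis *)

Section Blocks.
Context {R : realType} (V : gradedVect R) (l k : int) (kl : l = - (2 * k)).
Context (g : gform V) (gmetric : is_metric l g) (n p q : nat).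
Hypothesis n_max : forall i : nat, (n < i)%N -> gdim V (k + i%:Z) = 0%N.
Variables (e : (p + q).-tuple (V k))
  (t : forall i : 'I_n, (gdim V (k + i.+1%:Z)).-tuple (V (k + i.+1%:Z)))
  (tbar : forall i : 'I_n, (gdim V (k + i.+1%:Z)).-tuple (V (k - i.+1%:Z))).
Hypothesis std : standard_total_basis g e t tbar.
Arguments g : clear implicits.
Arguments t : clear implicits.
Arguments tbar : clear implicits.

Let r (i : 'I_n) := gdim V (k + i.+1%:Z).
Let e_basis : basis_of {:V k} e. Proof. by case: std => -[]. Qed.
Let t_basis (i : 'I_n) : basis_of {:V (k + i.+1%:Z)} (t i).
Proof. by case: std => -[_ /(_ i) []]. Qed.
Let tbar_basis (i : 'I_n) : basis_of {:V (k - i.+1%:Z)} (tbar i).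
Proof. by case: std => -[_ /(_ i) []]. Qed.

(** A second enumeration of the degrees, centred at [k] and adapted to the standard total basis. *)
Definition block_deg (o : option ('I_n * bool)) : int :=
  match o with
  | None => k
  | Some (i, b) => if b then k + i.+1%:Z else k - i.+1%:Z
  end.

Lemma block_deg_inj : injective block_deg.
Proof.
by move=> [[i [|]]|] [[j [|]]|] //= E; first [congr (Some (_, _)); apply: val_inj => /= | exfalso]; lia.
Qed.

(** Above [k + n] the spaces vanish by [n_max]. Below [k - n], the metric identifies [V j] with the
    dual of the space in degree [2k - j], which lies above [k + n]. *)
Lemma block_deg_cover j : (exists o, block_deg o = j) \/ (forall v : V j, v = 0).
Proof.
have [gb _ _ gbij] := gmetric.
have small (m : nat) : (n < m)%N -> forall v : V (k + m%:Z), v = 0.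
  by move=> nm; apply: dim0_all0; apply: n_max.
have [-> |jk] := eqVneq j k; first by left; exists None.
have [lt|le] := ltnP n (absz (j - k)%R); last first.
  (* The predecessor appears because the index [i] stands for the distance [i + 1] from [k]. *)
  left; have lti : ((absz (j - k)%R).-1 < n)%N by lia.
  by have [kj|kj] := lerP k j; [exists (Some (Ordinal lti, true))|
    exists (Some (Ordinal lti, false))]; rewrite /=; lia.
right=> v; have [kj|kj] := lerP k j.
  have ej : j = k + (absz (j - k)%R)%:Z by lia.
  by move: v; rewrite ej; apply: small.
apply: (bij_inj (gbij j)); apply/lfunP => w.
have ej : - (j + l) = k + (absz (j - k)%R)%:Z by lia.
have -> : w = 0 by move: w; rewrite ej; apply: small.
by rewrite !linear0.
Qed.

(** The blocks [M'] below degree [k] are kept independent of the blocks [M] above it, which makes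
    the construction linear in its arguments. *)
Definition block_maps (M0 : 'M[R]_(p + q)) (M M' : forall i, 'M[R]_(r i)) o :
    'End(V (block_deg o)) :=
  match o with
  | None => hom_of_matrix e M0
  | Some (i, b) =>
      if b as b return 'End(V (block_deg (Some (i, b))))
      then hom_of_matrix (t i) (M i) else hom_of_matrix (tbar i) (M' i)
  end.

Definition of_blocks M0 M M' : gEnd V :=
  extend (fun j => 0 : 'End(V j)) (block_maps M0 M M').

Lemma of_blocksE M0 M M' o : of_blocks M0 M M' (block_deg o) = block_maps M0 M M' o.
Proof. exact: (extendE _ _ _ block_deg_inj). Qed.

Lemma of_blocks_linear c M0 M M' N0 N N' P0 P P' j :
  P0 = c *: M0 + N0 -> (forall i, P i = c *: M i + N i) ->
  (forall i, P' i = c *: M' i + N' i) ->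
  of_blocks P0 P P' j = c *: of_blocks M0 M M' j + of_blocks N0 N N' j.
Proof.
move=> E0 E E'; apply: (extend_linear (T := fun j => 'End(V j))) => -[[i [|]]|] /=.
- by rewrite E (hom_of_matrix_linear (t_basis i)).
- by rewrite E' (hom_of_matrix_linear (tbar_basis i)).
- by rewrite E0 (hom_of_matrix_linear e_basis).
Qed.

Lemma gEnd_block_eq (A B : gEnd V) :
  (forall o, A (block_deg o) = B (block_deg o)) -> A = B.
Proof.
move=> AB; apply: functional_extensionality_dep => j.
have [[d <-]|V0] := block_deg_cover j; first exact: AB.
by apply/lfunP => v; rewrite (V0 v) !linear0.
Qed.

Lemma gram_e : gram e e (g k k) = Defs.eta p q.
Proof. by case: std => _ E _; apply/matrixP => a b; rewrite mxE E. Qed.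

Lemma gram_t (i : 'I_n) : gram (t i) (tbar i) (g (k + i.+1%:Z) (k - i.+1%:Z)) = 1%:M.
Proof. by case: std => _ _ E; apply/matrixP => a b; rewrite !mxE E. Qed.

Local Notation G1 := (O_group l g).
Local Notation G2 := (@prod_group R p q n r).

(** In dual bases the isometry condition reads [M^T M' = 1], whose solution is the transposed
    inverse. *)
Definition from_blocks (y : eg_type G2) : eg_type G1 :=
  of_blocks y.1 y.2 (fun i => (invmx (y.2 i))^T).

Lemma from_blocks_GL y : @eg_set R G2 y -> is_GL (from_blocks y).
Proof.
move=> [y1 y2] j; have [[d <-]|V0] := block_deg_cover j; last first.
  by exists id => v; rewrite (V0 v) ?linear0 // V0.
rewrite /from_blocks of_blocksE; case: d => [[i [|]]|] /=.
- by apply/(matrix_in_basis_unit (t_basis i)); rewrite hom_of_matrixK //; apply: y2.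
- apply/(matrix_in_basis_unit (tbar_basis i)).
  by rewrite hom_of_matrixK // unitmx_tr unitmx_inv; apply: y2.
- by apply/(matrix_in_basis_unit e_basis); rewrite hom_of_matrixK //; apply: Opq_unit.
Qed.

(** Nonzero pairings need degrees of sum [2k]: [k] with itself, or [k + i] with [k - i] in either
    order. *)
Lemma from_blocks_set y : @eg_set R G2 y -> @eg_set R G1 (from_blocks y).
Proof.
have [gb gdeg gsym _] := gmetric.
move=> yS; have [y1 y2] := yS; apply/is_OP => //; split; first exact: from_blocks_GL.
have pair_t (i : 'I_n) v w : g (k + i.+1%:Z) (k - i.+1%:Z)
    (hom_of_matrix (t i) (y.2 i) v) (hom_of_matrix (tbar i) (invmx (y.2 i))^T w) =
    g (k + i.+1%:Z) (k - i.+1%:Z) v w.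
  move: v w; apply/(isometryP (t_basis i) (tbar_basis i) (gb _ _)).
  rewrite gram_t !hom_of_matrixK // mulmx1 -trmx_mul mulVmx ?trmx1 //.
  exact: y2.
move=> i j v w; have [ijl|ijl] := eqVneq (i + j + l) 0; last by rewrite !gdeg.
have [[d ed]|V0] := block_deg_cover i; last first.
  by rewrite (V0 v) linear0 !(bilin0 (gb _ _)).1.
subst i; case: d v ijl => [[i [|]]|] v ijl.
- have ej : j = block_deg (Some (i, false)) by move: ijl; rewrite /= => /eqP; lia.
  subst j; rewrite /from_blocks !of_blocksE; exact: pair_t.
- have ej : j = block_deg (Some (i, true)) by move: ijl; rewrite /= => /eqP; lia.
  (* Graded symmetry puts the same sign on both sides and reduces this order to the previous one. *)
  subst j; rewrite /from_blocks !of_blocksE gsym [RHS]gsym; congr (_ * _).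
  exact: pair_t.
- have ej : j = block_deg None by move: ijl; rewrite /= => /eqP; lia.
  subst j; rewrite /from_blocks !of_blocksE /=.
  move: v w; apply/(isometryP e_basis e_basis (gb _ _)).
  by rewrite gram_e !hom_of_matrixK.
Qed.

Lemma blocks_set A : @eg_set R G1 A -> @eg_set R G2 (matrix_blocks e t A).
Proof.
have [gb _ _ _] := gmetric.
move/is_OP => /(_ gmetric) [GA HA]; split=> [|i] /=.
  by rewrite -gram_e; apply/(isometryP e_basis e_basis (gb _ _)) => v w; apply: HA.
by apply/(matrix_in_basis_unit (t_basis i)).
Qed.

Lemma from_blocksK y : matrix_blocks e t (from_blocks y) = y.
Proof.
case: y => y1 y2; pose E := of_blocksE y1 y2 (fun i => (invmx (y2 i))^T).
congr pair.
  (* [block_deg None] is [k] only by computation, so the equation is composed rather than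
     rewritten. *)
  apply: etrans (congr1 (matrix_in_basis e) (E None)) _.
  exact: hom_of_matrixK.
apply: functional_extensionality_dep => i.
apply: etrans (congr1 (matrix_in_basis (t i)) (E (Some (i, true)))) _.
exact: hom_of_matrixK.
Qed.

(** The component of [A] in degree [k - i] is forced: invariance of the pairing makes it the
    transposed inverse of the one in degree [k + i]. *)
Lemma blocksK A : @eg_set R G1 A -> from_blocks (matrix_blocks e t A) = A.
Proof.
have [gb _ _ _] := gmetric.
move=> AS; have [_ uA] := blocks_set AS.
have [GA HA] := (is_OP gmetric A).1 AS.
apply: gEnd_block_eq => o; rewrite /from_blocks of_blocksE; case: o => [[i [|]]|] /=.
- by apply: (matrix_in_basis_inj (t_basis i)); rewrite hom_of_matrixK.
- apply: (matrix_in_basis_inj (tbar_basis i)); rewrite hom_of_matrixK //.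
  have E : (matrix_in_basis (t i) (A _))^T *m matrix_in_basis (tbar i) (A _) = 1%:M.
    (* The right-hand identity and one inserted between the factors are read as the Gram matrix, so
       that [isometryP] applies. *)
    rewrite -(gram_t i) -[X in X *m _]mulmx1 -{1}(gram_t i).
    by apply/(isometryP (t_basis i) (tbar_basis i) (gb _ _)) => v w; apply: HA.
  have uT : (matrix_in_basis (t i) (A (k + i.+1%:Z)))^T \in unitmx.
    by rewrite unitmx_tr; apply: uA.
  by apply: (can_inj (mulKmx uT)); rewrite E trmx_inv mulmxV.
- by apply: (matrix_in_basis_inj e_basis); rewrite hom_of_matrixK.
Qed.

Lemma blocksM A B : matrix_blocks e t (@eg_mul R G1 A B) =
  @eg_mul R G2 (matrix_blocks e t A) (matrix_blocks e t B).
Proof.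
congr pair; first exact: matrix_in_basisM.
by apply: functional_extensionality_dep => i; apply: matrix_in_basisM.
Qed.

(** After decoding, the map is linear on the whole coordinate space. *)
Lemma blocks_smooth : smooth_wrt (@eg_set R G1) (@eg_coord R G1)
  (fun A => @eg_coord R G2 (matrix_blocks e t A)).
Proof.
pose L v := @eg_coord R G2 (matrix_blocks e t (@gEnd_decode R V l g v)).
have lL : linear L.
  move=> c v w; apply: prod_coord_linear => -[i|] /=;
    by rewrite gEnd_decode_linear matrix_in_basis_linear.
apply: smooth_wrt_eq (smooth_wrt_linear lL (@smooth_wrt_id _ _ _ _ _)) => A _.
by rewrite /L gEnd_decodeK.
Qed.

(** [L1] places the blocks of [y] in degrees at least [k], and [L2] the transposed blocks of the
    inverse of [y] below; inversion is smooth by [prod_group_is_lie]. *)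
Lemma from_blocks_smooth : smooth_wrt (@eg_set R G2) (@eg_coord R G2)
  (fun y => @eg_coord R G1 (from_blocks y)).
Proof.
pose B o v := @prod_block R p q n r o v.
pose L1 v := @eg_coord R G1 (of_blocks (B None v) (fun i => B (Some i) v) (fun=> 0)).
pose L2 v := @eg_coord R G1 (of_blocks 0 (fun=> 0) (fun i => (B (Some i) v)^T)).
have l1 : linear L1.
  move=> c v w; apply: gEnd_coord_linear => j; apply: of_blocks_linear => [|i|i].
  - by rewrite /B prod_block_linear.
  - by rewrite /B prod_block_linear.
  - by rewrite scaler0 addr0.
have l2 : linear L2.
  move=> c v w; apply: gEnd_coord_linear => j; apply: of_blocks_linear => [|i|i].
  - by rewrite scaler0 addr0.
  - by rewrite scaler0 addr0.
  - by rewrite /B prod_block_linear linearP.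
have [_ _ _ _ sV] := prod_group_is_lie (R := R) p q r.
have s1 := smooth_wrt_linear l1 (@smooth_wrt_id _ _ _ (@eg_set R G2) (@eg_coord R G2)).
apply: smooth_wrt_eq (smooth_wrt_add s1 (smooth_wrt_linear l2 sV)) => y _.
(* The coefficient 1 gives the sum the shape expected by [gEnd_coord_linear]. *)
rewrite -[L1 _]scale1r; apply/esym; apply: gEnd_coord_linear => j.
apply: of_blocks_linear => [|i|i]; rewrite /B !prod_block_coord /=.
- by rewrite scale1r addr0.
- by rewrite scale1r addr0.
- by rewrite scaler0 add0r.
Qed.

Lemma blocks_isomorphism : @lie_isomorphism R G1 G2 (matrix_blocks e t).
Proof.
have G1lie := O_group_is_lie gmetric.
have [G1grp _ _ _ _] := G1lie; have [_ mul1 _ _] := G1grp.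
split=> //; first exact: prod_group_is_lie.
  by split; [exact: blocks_set|move=> *; exact: blocksM|exact: blocks_smooth].
exists from_blocks; split; last by move=> y _; apply: from_blocksK.
  split; [exact: from_blocks_set| |exact: from_blocks_smooth].
  (* Multiplicativity of the inverse: [x] and [y] are written as images, and [blocksK] applies to
     the product of their preimages, which stays in the group. *)
  move=> x y Sx Sy; rewrite -{1}(from_blocksK x) -{1}(from_blocksK y) -blocksM.
  by rewrite blocksK //; apply: mul1; apply: from_blocks_set.
exact: blocksK.
Qed.

End Blocks.

Theorem proposition10p6 (R : realType) (V : gradedVect R)
  (Vnonzero : exists j : int, gdim V j <> 0%N)
  (l k : int) (kl : l = - (2 * k)) (keven : (2 %| k)%Z)
  (g : gform V) (gmetric : is_metric l g)
  (i0 : nat) (i0_nz : gdim V (k + i0%:Z) <> 0%N)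
  (i0_max : forall i : nat, (i0 < i)%N -> gdim V (k + i%:Z) = 0%N)
  (p q : nat) (sig : has_signature (g k k) p q)
  (e : (p + q).-tuple (V k))
  (t : forall i : 'I_i0, (gdim V (k + i.+1%:Z)).-tuple (V (k + i.+1%:Z)))
  (tbar : forall i : 'I_i0, (gdim V (k + i.+1%:Z)).-tuple (V (k - i.+1%:Z)))
  (std : standard_total_basis g e t tbar) :
  @lie_isomorphism R (O_group l g)
    (lie_prod (Opq p q) (lie_bigprod (fun i : 'I_i0 => GLn (gdim V (k + i.+1%:Z)))))
    (matrix_blocks e t).
Proof. exact: (blocks_isomorphism kl gmetric i0_max std). Qed.
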